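(* Let $p$ be a prime number and let $u:A\to B$ be a morphism of noetherian rings of characteristic $p>0$. Suppose that: (a) $B$ has a $p$-basis over $A$; (b) the ring morphism $\omega_{B/A}:A^{(p)}\otimes_A B\to B^{(p)}$, $\omega_{B/A}(a\otimes b)=u(a)\cdot b^p$, is injective. Then $u$ is smooth.
   Context: Rings are commutative with unit. A ring of characteristic $p$ means a ring containing a field of characteristic $p$. For such a ring $A$, $A^{(p)}$ denotes the $A$-algebra given by the ring $A$ with structure morphism the Frobenius endomorphism $F_A:A\to A$, $a\mapsto a^p$; similarly $B^{(p)}$ is the ring $B$ viewed as a $B$-algebra via the Frobenius of $B$. For $u:A\to B$, the tensor product $A^{(p)}\otimes_A B$ is formed using $F_A$ and $u$. $p$-basis: a family $\{b_i\}_{i\in I}$ of elements of $B$ is a $p$-basis of $B$ over $A$ if the monomials $\prod_{i} b_i^{e_i}$, with $0\le e_i<p$ and $e_i=0$ for all but finitely many $i$, form a basis of $B$ as a module over the subring $A[B^p]$ of $B$ generated by $u(A)$ and $B^p=\{b^p: b\in B\}$. Smooth: a ring morphism $u:A\to B$ is smooth (no finiteness assumption) if it is formally smooth for the discrete topologies, i.e. for every $A$-algebra $C$ and every ideal $J\subset C$ with $J^2=0$, every $A$-algebra morphism $B\to C/J$ lifts to an $A$-algebra morphism $B\to C$. *)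

(* Defs.v *)
From HB Require Import structures.
From mathcomp Require Import all_boot all_algebra finmap.
From mathcomp Require Import boolp classical_sets.

Set Implicit Arguments.
Unset Strict Implicit.
Unset Printing Implicit Defensive.

Import GRing.Theory.
Local Open Scope ring_scope.
Local Open Scope quotient_scope.

(* The zero ring is allowed and ideals need not be proper, unlike in
   [ring_quotient], whose quotient rings are all nonzero. *)

Definition ideal_closed (R : comPzRingType) (I : set R) : Prop :=
  [/\ I 0, forall x y, I x -> I y -> I (x + y) &
      forall a x, I x -> I (a * x)].

Record ideal (R : comPzRingType) := Ideal {
  ideal_set :> R -> Prop;
  idealP : ideal_closed ideal_set }.

Definition ideal_pred (R : comPzRingType) (I : ideal R) : {pred R} :=
  fun x => x \in (ideal_set I : set R).

Lemma ideal_predE (R : comPzRingType) (I : ideal R) (x : R) :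
  x \in ideal_pred I <-> I x.
Proof. by split=> [/set_mem|/mem_set]. Qed.

Lemma ideal_zmod_closed (R : comPzRingType) (I : ideal R) :
  zmod_closed (ideal_pred I).
Proof.
have [I0 ID IM] := idealP I; split; first exact/ideal_predE.
move=> x y /ideal_predE Ix /ideal_predE Iy; apply/ideal_predE.
by apply: ID => //; rewrite -mulN1r; apply: IM.
Qed.

HB.instance Definition _ (R : comPzRingType) (I : ideal R) :=
  GRing.isZmodClosed.Build R (ideal_pred I) (ideal_zmod_closed I).

Section QuotientRing.
Variables (R : comPzRingType) (I : ideal R).

Definition quot_ring : Type := {ideal_quot ideal_pred I}.

HB.instance Definition _ := GRing.Zmodule.on quot_ring.

Definition quot_pi (x : R) : quot_ring := \pi_({ideal_quot ideal_pred I}) x.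

Lemma quot_piP x y : quot_pi x = quot_pi y <-> I (x - y).
Proof.
rewrite -ideal_predE; split=> [/eqP|].
  by rewrite /quot_pi piE Quotient.equivE.
by move=> h; apply/eqP; rewrite /quot_pi piE Quotient.equivE.
Qed.

Lemma quot_pi_surj (q : quot_ring) : exists x, quot_pi x = q.
Proof. by exists (repr (q : {ideal_quot ideal_pred I})); apply: reprK. Qed.

Lemma quot_piB : zmod_morphism quot_pi.
Proof. exact: pi_is_zmod_morphism. Qed.

HB.instance Definition _ :=
  GRing.isZmodMorphism.Build R quot_ring quot_pi quot_piB.

Definition quot_mul (q r : quot_ring) : quot_ring :=
  quot_pi (repr (q : {ideal_quot ideal_pred I}) *
           repr (r : {ideal_quot ideal_pred I})).

Lemma quot_mulE x y : quot_mul (quot_pi x) (quot_pi y) = quot_pi (x * y).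
Proof.
have [_ ID IM] := idealP I.
have I_repr z : I (repr (\pi_({ideal_quot ideal_pred I}) z) - z).
  by apply/quot_piP; apply: reprK.
apply/quot_piP; rewrite /quot_pi.
set x' := repr _; set y' := repr _.
have -> : x' * y' - x * y = x' * (y' - y) + y * (x' - x).
  by rewrite !mulrBr [y * x']mulrC [y * x]mulrC addrA subrK.
by apply: ID; apply: IM; apply: I_repr.
Qed.

Lemma quot_mulA : associative quot_mul.
Proof.
move=> a b c; have [x <-] := quot_pi_surj a; have [y <-] := quot_pi_surj b.
by have [z <-] := quot_pi_surj c; rewrite !quot_mulE mulrA.
Qed.

Lemma quot_mulC : commutative quot_mul.
Proof.
move=> a b; have [x <-] := quot_pi_surj a; have [y <-] := quot_pi_surj b.
by rewrite !quot_mulE mulrC.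
Qed.

Lemma quot_mul1 : left_id (quot_pi 1) quot_mul.
Proof. by move=> a; have [x <-] := quot_pi_surj a; rewrite quot_mulE mul1r. Qed.

Lemma quot_mulDl : left_distributive quot_mul +%R.
Proof.
move=> a b c; have [x <-] := quot_pi_surj a; have [y <-] := quot_pi_surj b.
by have [z <-] := quot_pi_surj c; rewrite -raddfD !quot_mulE -raddfD mulrDl.
Qed.

HB.instance Definition _ := GRing.Zmodule_isComPzRing.Build quot_ring
  quot_mulA quot_mulC quot_mul1 quot_mulDl.

Lemma quot_pi_monoid : monoid_morphism quot_pi.
Proof. by split=> // x y; rewrite -quot_mulE. Qed.

HB.instance Definition _ :=
  GRing.isMonoidMorphism.Build R quot_ring quot_pi quot_pi_monoid.

End QuotientRing.

Arguments quot_pi {R} I x.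

Definition noetherian (R : comPzRingType) : Prop :=
  forall I : ideal R, exists s : seq R, forall x : R,
    I x <-> exists c : 'I_(size s) -> R, x = \sum_(i < size s) c i * s`_i.

Definition smooth (A B : comPzRingType) (u : {rmorphism A -> B}) : Prop :=
  forall (C : comPzRingType) (phi : {rmorphism A -> C}) (J : ideal C),
    (forall x y, J x -> J y -> x * y = 0) ->
  forall g : {rmorphism B -> quot_ring J},
    (forall a, g (u a) = quot_pi J (phi a)) ->
  exists h : {rmorphism B -> C},
    (forall a, h (u a) = phi a) /\ (forall b, quot_pi J (h b) = g b).

(* S \otimes_R T, for S and T viewed as R-algebras through f and g: finite
   formal sums of pure tensors, modulo the smallest additive congruence that
   makes the pure tensor R-balanced and biadditive.  Opposites exist because
   (- x) \otimes y is the opposite of x \otimes y. *)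
Section TensorProduct.
Variables (R S T : comPzRingType).
Variables (f : {rmorphism R -> S}) (g : {rmorphism R -> T}).

Inductive tensor_rel : seq (S * T) -> seq (S * T) -> Prop :=
| TensorRefl s : tensor_rel s s
| TensorSym s t : tensor_rel s t -> tensor_rel t s
| TensorTrans s t r : tensor_rel s t -> tensor_rel t r -> tensor_rel s r
| TensorCat s s' t t' :
    tensor_rel s s' -> tensor_rel t t' -> tensor_rel (s ++ t) (s' ++ t')
| TensorCatC s t : tensor_rel (s ++ t) (t ++ s)
| TensorZero y : tensor_rel [:: (0, y)] [::]
| TensorDl x x' y : tensor_rel [:: (x + x', y)] [:: (x, y); (x', y)]
| TensorDr x y y' : tensor_rel [:: (x, y + y')] [:: (x, y); (x, y')]
| TensorZ a x y : tensor_rel [:: (f a * x, y)] [:: (x, g a * y)].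

Definition tensor_relb (s t : seq (S * T)) : bool := `[< tensor_rel s t >].

Lemma tensor_relb_equiv : equiv_class_of tensor_relb.
Proof.
split=> [s|s t|t s r]; first exact/asboolP/TensorRefl.
  by apply/asboolP/asboolP; apply: TensorSym.
by move=> /asboolP h /asboolP k; apply/asboolP/(TensorTrans h k).
Qed.

Canonical tensor_equiv := EquivRelPack tensor_relb_equiv.
Canonical tensor_encModRel := defaultEncModRel tensor_relb.

Definition tensor : Type := {eq_quot tensor_relb}.
HB.instance Definition _ := Choice.on tensor.

Definition tensor_pi (s : seq (S * T)) : tensor := \pi_({eq_quot tensor_relb}) s.
Definition tensor_repr (q : tensor) : seq (S * T) :=
  repr (q : {eq_quot tensor_relb}).

Definition tens (x : S) (y : T) : tensor := tensor_pi [:: (x, y)].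

Lemma tensor_piP s t : tensor_pi s = tensor_pi t <-> tensor_rel s t.
Proof.
split=> [/eqmodP/asboolP //|h]; exact/eqmodP/asboolP.
Qed.

Lemma tensor_reprK q : tensor_pi (tensor_repr q) = q.
Proof. exact: reprK. Qed.

Definition fsum_opp (s : seq (S * T)) := [seq (- x.1, x.2) | x <- s].
Definition fsum_mul (s t : seq (S * T)) :=
  [seq (x.1 * y.1, x.2 * y.2) | x <- s, y <- t].

Lemma tensor_relN x y : tensor_rel [:: (- x, y); (x, y)] [::].
Proof.
apply: TensorTrans (TensorSym (TensorDl (- x) x y)) _.
by rewrite addNr; apply: TensorZero.
Qed.

Lemma fsum_oppP s : tensor_rel (fsum_opp s ++ s) [::].
Proof.
elim: s => [|[x y] s IH] /=; first exact: TensorRefl.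
apply: (@TensorTrans _ ([:: (- x, y); (x, y)] ++ (fsum_opp s ++ s))).
  apply: (@TensorCat [:: (- x, y)] [:: (- x, y)] (fsum_opp s ++ (x, y) :: s)
    ((x, y) :: fsum_opp s ++ s)); first exact: TensorRefl.
  rewrite -[(x, y) :: s]cat1s -[(x, y) :: _ ++ s]cat1s !catA.
  by apply: TensorCat; [apply: TensorCatC | apply: TensorRefl].
exact: TensorCat (tensor_relN x y) IH.
Qed.

Lemma fsum_mul_cons x s t : fsum_mul (x :: s) t = fsum_mul [:: x] t ++ fsum_mul s t.
Proof. by rewrite /fsum_mul /= cats0. Qed.

Lemma fsum_mul_consr s x t :
  tensor_rel (fsum_mul s (x :: t)) (fsum_mul s [:: x] ++ fsum_mul s t).
Proof.
elim: s => [|y s IH]; first exact: TensorRefl.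
rewrite (fsum_mul_cons y s (x :: t)) (fsum_mul_cons y s [:: x]).
rewrite (fsum_mul_cons y s t).
have -> : fsum_mul [:: y] (x :: t) = fsum_mul [:: y] [:: x] ++ fsum_mul [:: y] t.
  by [].
move: IH; move: (fsum_mul s _) (fsum_mul s [:: x]) (fsum_mul s t).
move: (fsum_mul [:: y] [:: x]) (fsum_mul [:: y] t) => a b c d e IH.
rewrite -!catA; apply: TensorCat; first exact: TensorRefl.
apply: (TensorTrans (TensorCat (TensorRefl b) IH)).
rewrite !catA; apply: TensorCat; last exact: TensorRefl.
exact: TensorCatC.
Qed.

Lemma fsum_mulC s t : tensor_rel (fsum_mul s t) (fsum_mul t s).
Proof.
elim: s => [|x s IH].
  by elim: t => [|y t IH]; [exact: TensorRefl | exact: IH].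
apply: TensorTrans (TensorSym (fsum_mul_consr t x s)).
rewrite fsum_mul_cons.
apply: TensorCat IH; suff -> : fsum_mul [:: x] t = fsum_mul t [:: x].
  exact: TensorRefl.
elim: t => //= y t IH; rewrite /fsum_mul /= in IH *.
by rewrite IH [x.1 * _]mulrC [x.2 * _]mulrC.
Qed.

Lemma fsum_mul_rell s s' t :
  tensor_rel s s' -> tensor_rel (fsum_mul s t) (fsum_mul s' t).
Proof.
have catE a b r : fsum_mul (a ++ b) r = fsum_mul a r ++ fsum_mul b r.
  exact: allpairs_cat.
have single a b : (forall y, tensor_rel (fsum_mul a [:: y]) (fsum_mul b [:: y])) ->
    tensor_rel (fsum_mul a t) (fsum_mul b t).
  move=> h; elim: t => [|y r IH].
    exact: (TensorTrans (fsum_mulC a [::]) (fsum_mulC [::] b)).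
  apply: TensorTrans (fsum_mul_consr _ _ _) _.
  exact: TensorTrans (TensorCat (h y) IH) (TensorSym (fsum_mul_consr _ _ _)).
elim=> {s s'} [s|s s' _ h|s s' r _ h _ k|s s' r r' _ h _ k|s r|y|x x' y|x y y'|a x y].
- exact: TensorRefl.
- exact: TensorSym.
- exact: TensorTrans h k.
- by rewrite !catE; apply: TensorCat.
- by rewrite !catE; apply: TensorCatC.
- by apply: single => z; rewrite /fsum_mul /= mul0r; apply: TensorZero.
- by apply: single => z; rewrite /fsum_mul /= mulrDl; apply: TensorDl.
- by apply: single => z; rewrite /fsum_mul /= mulrDl; apply: TensorDr.
- by apply: single => z; rewrite /fsum_mul /= -!mulrA; apply: TensorZ.
Qed.

Lemma fsum_mul_rel s s' t t' : tensor_rel s s' -> tensor_rel t t' ->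
  tensor_rel (fsum_mul s t) (fsum_mul s' t').
Proof.
move=> hs ht; apply: TensorTrans (fsum_mul_rell t hs) _.
apply: TensorTrans (fsum_mulC _ _) _.
exact: TensorTrans (fsum_mul_rell s' ht) (fsum_mulC _ _).
Qed.

Definition tensor_add (q r : tensor) :=
  tensor_pi (tensor_repr q ++ tensor_repr r).
Definition tensor_opp (q : tensor) := tensor_pi (fsum_opp (tensor_repr q)).
Definition tensor_mul (q r : tensor) :=
  tensor_pi (fsum_mul (tensor_repr q) (tensor_repr r)).

Lemma tensor_repr_pi s : tensor_rel (tensor_repr (tensor_pi s)) s.
Proof. by apply/tensor_piP; rewrite tensor_reprK. Qed.

Lemma tensor_addE s t :
  tensor_add (tensor_pi s) (tensor_pi t) = tensor_pi (s ++ t).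
Proof. by apply/tensor_piP; apply: TensorCat; apply: tensor_repr_pi. Qed.

Lemma tensor_mulE s t :
  tensor_mul (tensor_pi s) (tensor_pi t) = tensor_pi (fsum_mul s t).
Proof. by apply/tensor_piP; apply: fsum_mul_rel; apply: tensor_repr_pi. Qed.

Lemma tensor_addA : associative tensor_add.
Proof.
move=> a b c; rewrite -[a]tensor_reprK -[b]tensor_reprK -[c]tensor_reprK.
by rewrite !tensor_addE catA.
Qed.

Lemma tensor_addC : commutative tensor_add.
Proof. by move=> a b; apply/tensor_piP/TensorCatC. Qed.

Lemma tensor_add0 : left_id (tensor_pi [::]) tensor_add.
Proof. by move=> a; rewrite -[a]tensor_reprK tensor_addE. Qed.

Lemma tensor_addN : left_inverse (tensor_pi [::]) tensor_opp tensor_add.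
Proof.
move=> a; rewrite -{2}[a]tensor_reprK tensor_addE.
exact/tensor_piP/fsum_oppP.
Qed.

HB.instance Definition _ := GRing.isZmodule.Build tensor
  tensor_addA tensor_addC tensor_add0 tensor_addN.

Lemma fsum_mul1 x t : fsum_mul [:: x] t = [seq (x.1 * y.1, x.2 * y.2) | y <- t].
Proof. by rewrite /fsum_mul /= cats0. Qed.

Lemma fsum_mul_cat s t r : fsum_mul (s ++ t) r = fsum_mul s r ++ fsum_mul t r.
Proof. exact: allpairs_cat. Qed.

Lemma fsum_mulA s t r : fsum_mul s (fsum_mul t r) = fsum_mul (fsum_mul s t) r.
Proof.
elim: s => // x s IH; rewrite !(fsum_mul_cons x s) fsum_mul_cat IH.
congr (_ ++ _); elim: t {IH} => // y t IH; rewrite (fsum_mul_cons y t).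
rewrite fsum_mul1 map_cat -!fsum_mul1 IH.
rewrite -[fsum_mul [:: x] (y :: t)]/(_ :: fsum_mul [:: x] t).
rewrite (fsum_mul_cons _ (fsum_mul [:: x] t)); congr (_ ++ _).
by rewrite !fsum_mul1 -map_comp; apply: eq_map => z /=; rewrite !mulrA.
Qed.

Lemma tensor_mulA : associative tensor_mul.
Proof.
move=> a b c; rewrite -[a]tensor_reprK -[b]tensor_reprK -[c]tensor_reprK.
by rewrite !tensor_mulE fsum_mulA.
Qed.

Lemma tensor_mulC : commutative tensor_mul.
Proof. by move=> a b; apply/tensor_piP/fsum_mulC. Qed.

Lemma tensor_mul1 : left_id (tens 1 1) tensor_mul.
Proof.
move=> a; rewrite -[a]tensor_reprK tensor_mulE; congr tensor_pi.
rewrite /fsum_mul /= cats0 -[RHS]map_id; apply: eq_map => -[x y] /=.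
by rewrite !mul1r.
Qed.

Lemma tensor_mulDl : left_distributive tensor_mul +%R.
Proof.
move=> a b c; rewrite -[a]tensor_reprK -[b]tensor_reprK -[c]tensor_reprK.
have addE s t : tensor_pi s + tensor_pi t = tensor_pi (s ++ t).
  exact: tensor_addE.
by rewrite !(addE, tensor_mulE) fsum_mul_cat.
Qed.

HB.instance Definition _ := GRing.Zmodule_isComPzRing.Build tensor
  tensor_mulA tensor_mulC tensor_mul1 tensor_mulDl.

Lemma tensor_piE s : tensor_pi s = \sum_(x <- s) tens x.1 x.2.
Proof.
elim: s => [|[x y] s IH]; first by rewrite big_nil.
by rewrite big_cons -IH; apply: esym (tensor_addE [:: (x, y)] s).
Qed.

Lemma tensor_sum (q : tensor) :
  exists s : seq (S * T), q = \sum_(x <- s) tens x.1 x.2.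
Proof. by exists (tensor_repr q); rewrite -tensor_piE tensor_reprK. Qed.

Lemma tensDl x x' y : tens (x + x') y = tens x y + tens x' y.
Proof.
apply: etrans (esym (tensor_addE [:: (x, y)] [:: (x', y)])).
exact/tensor_piP/TensorDl.
Qed.

Lemma tensDr x y y' : tens x (y + y') = tens x y + tens x y'.
Proof.
apply: etrans (esym (tensor_addE [:: (x, y)] [:: (x, y')])).
exact/tensor_piP/TensorDr.
Qed.

Lemma tensM x x' y y' : tens (x * x') (y * y') = tens x y * tens x' y'.
Proof. exact: esym (tensor_mulE [:: (x, y)] [:: (x', y')]). Qed.

Lemma tens1 : tens 1 1 = 1.
Proof. by []. Qed.

Lemma tensZ a x y : tens (f a * x) y = tens x (g a * y).
Proof. exact/tensor_piP/TensorZ. Qed.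

Section Lift.
Variables (Q : comPzRingType).
Variables (h : {rmorphism S -> Q}) (k : {rmorphism T -> Q}).
Hypothesis hk : h \o f =1 k \o g.

Definition fsum_lift (s : seq (S * T)) : Q := \sum_(x <- s) h x.1 * k x.2.

Definition tensor_lift of (h \o f =1 k \o g) :=
  fun q : tensor => fsum_lift (tensor_repr q).

Lemma fsum_lift_rel s t : tensor_rel s t -> fsum_lift s = fsum_lift t.
Proof.
rewrite /fsum_lift; elim=> {s t} //= [s t r _ -> _ -> //|s s' t t' _ e _ e'|s t|y|x x' y|x y y'|a x y].
- by rewrite !big_cat /= e e'.
- by rewrite !big_cat /= addrC.
- by rewrite big_seq1 big_nil /= rmorph0 mul0r.
- by rewrite !big_cons big_nil /= !addr0 rmorphD mulrDl.
- by rewrite !big_cons big_nil /= !addr0 rmorphD mulrDr.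
- rewrite !big_seq1 /= !rmorphM -[k (g a)]hk /=.
  by rewrite mulrA [h (f a) * _]mulrC.
Qed.

Lemma tensor_lift_pi s : tensor_lift hk (tensor_pi s) = fsum_lift s.
Proof. exact/fsum_lift_rel/tensor_repr_pi. Qed.

Lemma tensor_lift_tens x y : tensor_lift hk (tens x y) = h x * k y.
Proof. by rewrite tensor_lift_pi /fsum_lift big_seq1. Qed.

Lemma tensor_lift_nmod : nmod_morphism (tensor_lift hk).
Proof.
split=> [|a b]; first by rewrite tensor_lift_pi /fsum_lift big_nil.
rewrite -[a]tensor_reprK -[b]tensor_reprK.
rewrite -[tensor_pi _ + tensor_pi _]/(tensor_add _ _).
by rewrite tensor_addE !tensor_lift_pi /fsum_lift big_cat.
Qed.

Lemma tensor_lift_monoid : monoid_morphism (tensor_lift hk).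
Proof.
split=> [|a b]; first by rewrite tensor_lift_tens !rmorph1 mulr1.
rewrite -[a]tensor_reprK -[b]tensor_reprK.
rewrite -[tensor_pi _ * tensor_pi _]/(tensor_mul _ _).
rewrite tensor_mulE !tensor_lift_pi /fsum_lift big_allpairs_dep /=.
rewrite big_distrlr /=; apply: eq_bigr => x _; apply: eq_bigr => y _.
by rewrite !rmorphM mulrACA.
Qed.

End Lift.

HB.instance Definition _ (Q : comPzRingType) (h : {rmorphism S -> Q})
    (k : {rmorphism T -> Q}) (hk : h \o f =1 k \o g) :=
  GRing.isNmodMorphism.Build tensor Q
    (@tensor_lift Q h k hk) (tensor_lift_nmod hk).
HB.instance Definition _ (Q : comPzRingType) (h : {rmorphism S -> Q})
    (k : {rmorphism T -> Q}) (hk : h \o f =1 k \o g) :=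
  GRing.isMonoidMorphism.Build tensor Q
    (@tensor_lift Q h k hk) (tensor_lift_monoid hk).

Lemma tensor_lift_unique (Q : comPzRingType)
    (h : {rmorphism S -> Q}) (k : {rmorphism T -> Q}) (hk : h \o f =1 k \o g)
    (l : {rmorphism tensor -> Q}) :
  (forall x, l (tens x 1) = h x) -> (forall y, l (tens 1 y) = k y) ->
  l =1 tensor_lift hk.
Proof.
move=> lh lk q; have [s ->] := tensor_sum q.
rewrite !rmorph_sum; apply: eq_bigr => -[x y] _ /=.
by rewrite tensor_lift_tens -lh -lk -rmorphM -tensM mulr1 mul1r.
Qed.

End TensorProduct.

Section CharacteristicP.
Variables (p : nat) (A B : comNzRingType) (u : {rmorphism A -> B}).

Section Omega.
Hypotheses (pA : p \in [pchar A]) (pB : p \in [pchar B]).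

Lemma omega_compat : u \o pFrobenius_aut pA =1 pFrobenius_aut pB \o u.
Proof. by move=> a /=; rewrite !pFrobenius_autE rmorphXn. Qed.

(* A^(p) \otimes_A B is A \otimes_A B for the Frobenius of A and u; B^(p) is B
   as a ring. *)
Definition omega :
    {rmorphism tensor (pFrobenius_aut pA) u -> B} :=
  tensor_lift omega_compat.

Lemma omegaE a b : omega (tens _ _ a b) = u a * b ^+ p.
Proof. by rewrite /omega /= tensor_lift_tens /= pFrobenius_autE. Qed.

End Omega.

Definition subring_ABp : set B :=
  smallest (fun S : set B => subring_closed (mem S))
    (range u `|` range (fun b : B => b ^+ p)).

End CharacteristicP.

Definition is_basis (B : comNzRingType) (S : set B) (K : choiceType)
    (m : K -> B) : Prop :=
  (forall x : B, exists2 c : {fsfun K -> B with 0},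
     (forall k, S (c k)) & x = \sum_(k <- finsupp c) c k * m k) /\
  (forall c : {fsfun K -> B with 0}, (forall k, S (c k)) ->
     \sum_(k <- finsupp c) c k * m k = 0 -> forall k, c k = 0).

(* Outside its support an exponent vanishes, so it is everywhere < p if 0 < p *)
Definition exponent (p : nat) (I : choiceType) : choiceType :=
  {e : {fsfun I -> nat with 0%N} | all (fun i => (e i < p)%N) (finsupp e)}.

Definition monomial (p : nat) (B : comNzRingType) (I : choiceType) (b : I -> B)
    (e : exponent p I) : B :=
  \prod_(i <- finsupp (val e)) b i ^+ val e i.

Definition p_basis (p : nat) (A B : comNzRingType) (u : {rmorphism A -> B})
    (I : choiceType) (b : I -> B) : Prop :=
  is_basis (subring_ABp p u) (@monomial p B I b).

(* Main.v *)
Require Import Defs.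
From HB Require Import structures.
From mathcomp Require Import all_boot all_algebra finmap.
From mathcomp Require Import boolp classical_sets.
Local Open Scope ring_scope.

(** Let [C] be an [A]-algebra, [J] an ideal with [J^2 = 0], and [g : B -> C/J]
    an [A]-algebra morphism.  Since [p >= 2], the [p]-th power kills [J]; as
    [C] has characteristic [p], the Frobenius of [C] factors through a ring
    morphism [quot_frob : C/J -> C].  Hence [psi = quot_frob \o g] sends [y] to
    the [p]-th power of any lift of [g y]: although [g y] has no preferred
    lift, its [p]-th power has one.

    This prescribes the lift [h] of [g].  With [phi] the structure morphism of
    [C], it must satisfy [h (u a) = phi a] and [h (y^p) = psi y]; for the
    members [b_i] of the [p]-basis, let [h b_i] be any lift [x_i] of [g b_i].
    These prescriptions fit together:
    - [phi] and [psi] agree over [A], so they define a morphism on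
      [A^(p) \otimes_A B]; injectivity of [omega] makes it a morphism on the
      subring [A[B^p]], which is the image of [omega] ([range_omega]);
    - [B] is [A[B^p]] with [p]-th roots [b_i] of the [b_i^p] freely adjoined,
      because the reduced monomials form a basis; and [psi b_i = x_i^p] by the
      choice of [x_i], so the morphism extends to [B] ([p_basis_extension]).
    Finally [quot_pi J \o h] and [g] coincide on [u(A)], on [B^p] and on the
    [b_i], hence everywhere ([p_basis_hom_ext]). *)

Import GRing.Theory.
Set Implicit Arguments.
Unset Strict Implicit.

(** * The Frobenius of a square-zero extension *)

(** Characteristic [p] is expressed by [p%:R = 0] rather than by [pchar]
    so that [R] may be the zero ring. *)
Lemma exprDn_prime (p : nat) (R : comPzRingType) (x y : R) :
  prime p -> p%:R = 0 :> R -> (x + y) ^+ p = x ^+ p + y ^+ p.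
Proof.
case: p => // p p_pr p0.
rewrite exprDn big_ord_recl big_ord_recr /= subn0 subnn bin0 binn !mulr1n.
rewrite expr0 mul1r mulr1 big1 ?add0r // => i _.
have /dvdnP[k ->] : (p.+1 %| 'C(p.+1, bump 0 i))%N
  by rewrite prime_dvd_bin //= ltnS ltn_ord.
by rewrite mulrnA -[LHS]mulr_natr p0 mulr0.
Qed.

Section SquareZero.
Variables (p : nat) (C : comPzRingType) (J : ideal C).
Hypotheses (p_prime : prime p) (pC : p%:R = 0 :> C).
Hypothesis JJ0 : forall x y, J x -> J y -> x * y = 0.

(** The Frobenius of [C], seen as defined on [C/J]: the choice of a lift is
    irrelevant by [quot_frobE]. *)
Definition quot_frob (q : quot_ring J) : C :=
  projT1 (cid (quot_pi_surj q)) ^+ p.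

(** Two lifts differ by some [j] in [J], and [j ^+ p = 0] since [p >= 2]. *)
Lemma quot_frobE x : quot_frob (quot_pi J x) = x ^+ p.
Proof.
rewrite /quot_frob; case: cid => y /= /quot_piP Jyx.
rewrite -[y](subrK x) exprDn_prime // -[RHS]add0r; congr (_ + _).
by rewrite -(subnKC (prime_gt1 p_prime)) exprD expr2 (JJ0 Jyx Jyx) mul0r.
Qed.

Lemma quot_frob_nmod : nmod_morphism quot_frob.
Proof.
split=> [|q r].
  by rewrite -(rmorph0 (quot_pi J)) quot_frobE expr0n gtn_eqF ?prime_gt0.
have [x <-] := quot_pi_surj q; have [y <-] := quot_pi_surj r.
by rewrite -rmorphD !quot_frobE exprDn_prime.
Qed.

Lemma quot_frob_monoid : monoid_morphism quot_frob.
Proof.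
split=> [|q r]; first by rewrite -(rmorph1 (quot_pi J)) quot_frobE expr1n.
have [x <-] := quot_pi_surj q; have [y <-] := quot_pi_surj r.
by rewrite -rmorphM !quot_frobE exprMn.
Qed.

HB.instance Definition _ :=
  GRing.isNmodMorphism.Build (quot_ring J) C quot_frob quot_frob_nmod.
HB.instance Definition _ :=
  GRing.isMonoidMorphism.Build (quot_ring J) C quot_frob quot_frob_monoid.

Definition quot_frob_rmorphism : {rmorphism quot_ring J -> C} := quot_frob.

End SquareZero.

(** * Monomials with reduced exponents *)

Section Monomials.
Variables (p : nat) (I : choiceType).
Hypothesis p_prime : prime p.
Implicit Types (e : {fsfun I -> nat with 0%N}) (K : {fset I}).

(** [monomial] over an arbitrary, possibly zero, commutative ring and for
    exponents that need not be reduced; on reduced exponents the two are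
    convertible. *)
Definition fsmonomial (R : comPzRingType) (x : I -> R) e : R :=
  \prod_(i <- finsupp e) x i ^+ e i.

Lemma fsmonomialE (R : comPzRingType) (x : I -> R) e K :
  (finsupp e `<=` K)%fset -> fsmonomial x e = \prod_(i <- K) x i ^+ e i.
Proof.
by move=> eK; apply: big_fset_incl => // i _ /fsfun_dflt ->; rewrite expr0.
Qed.

Lemma rmorph_fsmonomial (R S : comPzRingType) (f : {rmorphism R -> S})
    (x : I -> R) e : f (fsmonomial x e) = fsmonomial (f \o x) e.
Proof. by rewrite rmorph_prod; apply: eq_bigr => i _; rewrite rmorphXn. Qed.

Lemma exponent_mk e : (forall i, (e i < p)%N) ->
  exists e' : exponent p I, val e' = e.
Proof.
move=> e_lt; have e_all : all (fun i => (e i < p)%N) (finsupp e) by apply/allP.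
by exists (exist _ e e_all).
Qed.

Lemma exponent0 : exists e : exponent p I,
  forall (R : comPzRingType) (x : I -> R), fsmonomial x (val e) = 1.
Proof.
have [i|e e0] := @exponent_mk [fsfun]; first by rewrite fsfun0E prime_gt0.
by exists e => R x; rewrite e0 /fsmonomial finsupp0 big_seq_fset0.
Qed.

Lemma exponent1 i : exists e : exponent p I,
  forall (R : comPzRingType) (x : I -> R), fsmonomial x (val e) = x i.
Proof.
pose d : {fsfun I -> nat with 0%N} := [fsfun j in [fset i]%fset => 1%N].
have [j|e de] := @exponent_mk d.
  by rewrite fsfunE; case: ifP => _; rewrite ?prime_gt1 ?prime_gt0.
exists e => R x; rewrite de (@fsmonomialE _ _ _ [fset i]%fset) ?finsupp_sub //.
by rewrite big_seq_fset1 fsfunE inE eqxx expr1.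
Qed.

(** Division by [p] in the exponents: [x^(e1 + e2) = (x^q)^p * x^e] with [q] and
    [e] the quotients and remainders.  The witnesses [y = b^q] and [e] depend
    only on [b], so that one and the same reduction can be used in [B], with
    [f] the Frobenius, and in a ring to which [B] is to be mapped. *)
Lemma exponentM (B : comPzRingType) (b : I -> B) (e1 e2 : exponent p I) :
  exists (y : B) (e : exponent p I),
  forall (R : comPzRingType) (f : {rmorphism B -> R}) (x : I -> R),
    (forall i, f (b i) = x i ^+ p) ->
  fsmonomial x (val e1) * fsmonomial x (val e2) = f y * fsmonomial x (val e).
Proof.
pose K := (finsupp (val e1) `|` finsupp (val e2))%fset.
pose q : {fsfun I -> nat with 0%N} :=
  [fsfun i in K => ((val e1 i + val e2 i) %/ p)%N].
pose r : {fsfun I -> nat with 0%N} :=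
  [fsfun i in K => ((val e1 i + val e2 i) %% p)%N].
have [i|e er] := @exponent_mk r.
  by rewrite fsfunE; case: ifP => _; rewrite ?ltn_pmod ?prime_gt0.
exists (fsmonomial b q), e => R f x fb; rewrite er rmorph_fsmonomial.
rewrite !(@fsmonomialE _ _ _ K) ?finsupp_sub ?fsubsetUl ?fsubsetUr //.
rewrite -!big_split /=; apply: eq_big_seq => i iK.
by rewrite !fsfunE iK fb -exprM -!exprD mulnC -divn_eq.
Qed.

End Monomials.

(** * Morphisms out of a ring with a p-basis *)

Section Extension.
Variables (p : nat) (A B : comNzRingType) (u : {rmorphism A -> B}).
Hypotheses (p_prime : prime p).
Hypotheses (charA : p \in [pchar A]) (charB : p \in [pchar B]).
Local Notation D := (tensor (pFrobenius_aut charA) u).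
Local Notation om := (omega u charA charB).

Lemma omega_sum (q : D) : exists s : seq (A * B),
  om q = \sum_(t <- s) u t.1 * t.2 ^+ p.
Proof.
have [s ->] := tensor_sum q; exists s; rewrite rmorph_sum.
by apply: eq_bigr => t _; apply: omegaE.
Qed.

Lemma range_omega (x : B) : subring_ABp p u x <-> exists q : D, om q = x.
Proof.
split=> [|[q <-]].
  pose S : set B := [set y | exists q : D, om q = y]%classic.
  apply: (@smallest_sub _ _ _ S).
    split.
    - by apply/mem_set; exists 1; apply: rmorph1.
    - move=> _ _ /set_mem[q <-] /set_mem[r <-]; apply/mem_set.
      by exists (q - r); rewrite rmorphB.
    - move=> _ _ /set_mem[q <-] /set_mem[r <-]; apply/mem_set.
      by exists (q * r); rewrite rmorphM.
  move=> _ [[a _ <-]|[b _ <-]].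
    by exists (tens _ _ a 1); rewrite omegaE expr1n mulr1.
  by exists (tens _ _ 1 b); rewrite omegaE rmorph1 mul1r.
move=> S [S_ring S_gen]; have [s ->] := omega_sum q; apply/set_mem.
have SB := GRing.subring_closedB S_ring; have [_ _ SM] := S_ring.
apply: (big_ind (fun y => y \in mem S)) => [||[a b] _].
- exact: SB.1.
- exact: (GRing.zmod_closedD SB).2.
by apply: SM; apply/mem_set; apply: S_gen; [left; exists a|right; exists b].
Qed.

Variables (I : choiceType) (b : I -> B).
Hypothesis bP : p_basis p u b.

(** A list may repeat an exponent, unlike a finitely supported function: sums of
    such expressions are then mere concatenations. *)
Lemma p_basis_span (x : B) : exists s : seq (D * exponent p I),
  x = \sum_(t <- s) om t.1 * fsmonomial b (val t.2).
Proof.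
have [c cS ->] := bP.1 x.
have /choice[q qE] : forall k, exists q : D, om q = c k.
  by move=> k; apply/range_omega.
exists [seq (q k, k) | k <- finsupp c]; rewrite big_map.
by apply: eq_bigr => k _; rewrite qE.
Qed.

(** As a ring, [B] is generated by [u(A)], [B^p] and the [b_i]. *)
Lemma p_basis_hom_ext (R : comPzRingType) (f g : {rmorphism B -> R}) :
    (forall a, f (u a) = g (u a)) -> (forall y, f (y ^+ p) = g (y ^+ p)) ->
  (forall i, f (b i) = g (b i)) -> f =1 g.
Proof.
move=> fg_u fg_p fg_b x; have [s ->] := p_basis_span x.
rewrite !rmorph_sum; apply: eq_bigr => t _; rewrite !rmorphM.
congr (_ * _).
  have [r ->] := omega_sum t.1; rewrite !rmorph_sum.
  by apply: eq_bigr => v _; rewrite !rmorphM fg_u fg_p.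
by rewrite !rmorph_fsmonomial; apply: eq_bigr => i _ /=; rewrite fg_b.
Qed.

Hypothesis om_inj : injective om.
Variables (R : comPzRingType) (alpha : {rmorphism A -> R}).
Variables (beta : {rmorphism B -> R}) (x : I -> R).
Hypothesis alpha_beta : alpha \o pFrobenius_aut charA =1 beta \o u.
Hypothesis beta_b : forall i, beta (b i) = x i ^+ p.

(* The prescriptions [u a |-> alpha a] and [y ^+ p |-> beta y], combined, before
   they are transported to [A[B^p]] along [omega]. *)
Let k : {rmorphism D -> R} := tensor_lift alpha_beta.

Lemma tensor_liftE a y : k (tens _ _ a y) = alpha a * beta y.
Proof. exact: tensor_lift_tens. Qed.

(** The graph of the extension to be built.  Working with the graph makes
    compatibility with the ring operations visible before one knows that the
    value does not depend on the expression of [y]. *)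
Definition ext_graph (y : B) (z : R) : Prop :=
  exists s : seq (D * exponent p I),
    y = \sum_(t <- s) om t.1 * fsmonomial b (val t.2) /\
    z = \sum_(t <- s) k t.1 * fsmonomial x (val t.2).

Lemma ext_graph_term (q : D) (e : exponent p I) :
  ext_graph (om q * fsmonomial b (val e)) (k q * fsmonomial x (val e)).
Proof. by exists [:: (q, e)]; rewrite !big_seq1. Qed.

Lemma ext_graph0 : ext_graph 0 0.
Proof. by exists [::]; rewrite !big_nil. Qed.

Lemma ext_graphD y y' z z' :
  ext_graph y z -> ext_graph y' z' -> ext_graph (y + y') (z + z').
Proof.
by move=> [s [-> ->]] [t [-> ->]]; exists (s ++ t); rewrite !big_cat.
Qed.

Lemma ext_graphN y z : ext_graph y z -> ext_graph (- y) (- z).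
Proof.
move=> [s [-> ->]]; exists [seq (- t.1, t.2) | t <- s].
rewrite !big_map -!sumrN.
by split; apply: eq_bigr => t _; rewrite rmorphN mulNr.
Qed.

Lemma ext_graph_sum (T : Type) (s : seq T) (F : T -> B) (G : T -> R) :
  (forall t, ext_graph (F t) (G t)) ->
  ext_graph (\sum_(t <- s) F t) (\sum_(t <- s) G t).
Proof.
move=> FG; elim: s => [|t s IH]; first by rewrite !big_nil; apply: ext_graph0.
by rewrite !big_cons; apply: ext_graphD.
Qed.

(** The one place where [beta (b i) = x i ^+ p] is needed: the product of two
    reduced monomials is reduced in the same way on both sides, by extracting
    the factor [w ^+ p] of [B] and its counterpart [beta w]. *)
Lemma ext_graph_termM (q q' : D) (e e' : exponent p I) :
  ext_graph (om q * fsmonomial b (val e) * (om q' * fsmonomial b (val e')))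
            (k q * fsmonomial x (val e) * (k q' * fsmonomial x (val e'))).
Proof.
have [w [d wd]] := exponentM p_prime b e e'.
have bw : fsmonomial b (val e) * fsmonomial b (val e') =
    w ^+ p * fsmonomial b (val d) by apply: (wd _ (pFrobenius_aut charB)).
have om_w : om (q * q' * tens _ _ 1 w) = om q * om q' * w ^+ p.
  by rewrite !rmorphM omegaE rmorph1 mul1r.
have k_w : k (q * q' * tens _ _ 1 w) = k q * k q' * beta w.
  by rewrite !rmorphM tensor_liftE rmorph1 mul1r.
rewrite mulrACA bw (mulrA (om q * om q')) -om_w (mulrACA (k q)) (wd _ beta) //.
rewrite (mulrA (k q * k q')) -k_w; exact: ext_graph_term.
Qed.

Lemma ext_graphM y y' z z' :
  ext_graph y z -> ext_graph y' z' -> ext_graph (y * y') (z * z').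
Proof.
move=> [s [-> ->]] [t [-> ->]]; rewrite !big_distrlr.
by do 2!apply: ext_graph_sum => ?; apply: ext_graph_termM.
Qed.

(** Freeness of the reduced monomials makes the coefficients of an expression
    of [0] vanish in [B], and injectivity of [omega] makes them vanish already
    in the tensor product, hence after [k]. *)
Lemma ext_graph_fun0 z : ext_graph 0 z -> z = 0.
Proof.
move=> [s [s0 ->]].
(* Total coefficient of [e]: the list may repeat an exponent. *)
pose q e : D := \sum_(t <- s | t.2 == e) t.1.
pose K : {fset exponent p I} := [fset t.2 | t in s]%fset.
have regroup (Q : comPzRingType) (l : {rmorphism D -> Q}) (w : I -> Q) :
    \sum_(t <- s) l t.1 * fsmonomial w (val t.2) =
    \sum_(e <- K) l (q e) * fsmonomial w (val e).
  under [RHS]eq_bigr => e _ do rewrite rmorph_sum mulr_suml big_mkcond /=.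
  rewrite exchange_big /=; apply: eq_big_seq => t ts.
  have tK : t.2 \in K by apply/imfsetP; exists t.
  rewrite (big_fsetD1 t.2) //= eqxx big1_fset ?addr0 // => e.
  by rewrite !inE eq_sym => /andP[/negPf ->].
pose c : {fsfun exponent p I -> B with 0} := [fsfun e in K => om (q e)].
have cE e : e \in K -> c e = om (q e) by move=> eK; rewrite fsfunE eK.
have c0 : forall e, c e = 0.
  apply: bP.2 => [e|].
    rewrite fsfunE; case: ifP => _; apply/range_omega; first by exists (q e).
    by exists 0; apply: rmorph0.
  apply: etrans (esym s0); rewrite regroup.
  rewrite (@big_fset_incl _ _ _ _ _ K) ?finsupp_sub //.
    by apply: eq_big_seq => e eK; rewrite cE.
  by move=> e _ /fsfun_dflt ->; rewrite mul0r.
rewrite regroup big_seq big1 // => e eK.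
suff -> : q e = 0 by rewrite rmorph0 mul0r.
by apply: om_inj; rewrite rmorph0 -cE.
Qed.

Lemma ext_graph_fun y z z' : ext_graph y z -> ext_graph y z' -> z = z'.
Proof.
move=> yz yz'; apply/eqP; rewrite -subr_eq0; apply/eqP/ext_graph_fun0.
by rewrite -(subrr y); apply: ext_graphD yz (ext_graphN yz').
Qed.

(** [B] is [A^(p) \otimes_A B], embedded by [omega], with [p]-th roots [b i] of
    the elements [1 \otimes b i] freely adjoined: a morphism on [B] amounts to
    a compatible pair [alpha], [beta] together with [p]-th roots [x i] of the
    [beta (b i)]. *)
Lemma p_basis_extension : exists h : {rmorphism B -> R},
  [/\ forall a, h (u a) = alpha a, forall y, h (y ^+ p) = beta y &
      forall i, h (b i) = x i].
Proof.
have /choice[h hP] : forall y, exists z : R, ext_graph y z.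
  move=> y; have [s ->] := p_basis_span y.
  by exists (\sum_(t <- s) k t.1 * fsmonomial x (val t.2)), s.
have hE y z : ext_graph y z -> h y = z by apply: ext_graph_fun.
have graph_om q : ext_graph (om q) (k q).
  have [e e1] := exponent0 I p_prime.
  by have := ext_graph_term q e; rewrite !e1 !mulr1.
have h_nmod : nmod_morphism h.
  split=> [|y y']; first exact/hE/ext_graph0.
  by apply/hE/ext_graphD.
have h_monoid : monoid_morphism h.
  split=> [|y y']; last by apply/hE/ext_graphM.
  by have /hE := graph_om 1; rewrite !rmorph1.
pose hN := GRing.isNmodMorphism.Build B R h h_nmod.
pose hM := GRing.isMonoidMorphism.Build B R h h_monoid.
have h_tens a y : h (u a * y ^+ p) = alpha a * beta y.
  by apply: hE; rewrite -(omegaE u charA charB) -tensor_liftE.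
exists (HB.pack_for {rmorphism B -> R} h hN hM); split=> [a|y|i] /=.
- by rewrite -[u a]mulr1 -(expr1n B p) h_tens rmorph1 mulr1.
- by rewrite -[y ^+ p]mul1r -(rmorph1 u) h_tens rmorph1 mul1r.
have [e ei] := exponent1 p_prime i; apply: hE.
by have := ext_graph_term 1 e; rewrite !ei !rmorph1 !mul1r.
Qed.

End Extension.

Theorem theorem2p2 (p : nat) (A B : comNzRingType) (u : {rmorphism A -> B})
    (p_prime : prime p)
    (charA : p \in [pchar A]) (charB : p \in [pchar B])
    (noethA : noetherian A) (noethB : noetherian B)
    (pbasis : exists (I : choiceType) (b : I -> B), p_basis p u b)
    (omega_inj : injective (omega u charA charB)) :
  smooth u.
Proof.
case: pbasis => I [b bP] C phi J JJ0 g gu.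
have pC : p%:R = 0 :> C by rewrite -(rmorph_nat phi) pcharf0 ?rmorph0.
have [psi psiE] : exists psi : {rmorphism B -> C},
    forall y z, quot_pi J z = g y -> psi y = z ^+ p.
  exists (quot_frob_rmorphism p_prime pC JJ0 \o g) => y z zE.
  by rewrite /= -zE; apply: quot_frobE.
have compat : phi \o pFrobenius_aut charA =1 psi \o u.
  by move=> a; rewrite /= (psiE _ (phi a)) // pFrobenius_autE rmorphXn.
(* Any lifts will do: [psi (b i) = x i ^+ p] holds whatever the choice. *)
have /choice[x xE] : forall i, exists z : C, quot_pi J z = g (b i).
  by move=> i; apply: quot_pi_surj.
have [|h [h_u h_p h_b]] := @p_basis_extension p A B u p_prime charA charB I b bP
  omega_inj C phi psi x compat.
  by move=> i; apply: psiE.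
exists h; split=> //.
apply: (p_basis_hom_ext charA charB bP (f := quot_pi J \o h)) => [a|y|i] /=.
- by rewrite h_u gu.
- have [z zE] := quot_pi_surj (g y).
  by rewrite h_p (psiE _ z) // !rmorphXn -zE.
- by rewrite h_b.
Qed.
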